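(* For every $L \ge 1$ there is a constant $C \ge 1$, depending only on $L$, such that if $\Omega \subset \hat{\mathbb{C}}$ is an $L$-John domain, then $\partial \Omega$ has the discrete UWS property with constant $C$.
   Context: The Riemann sphere $\hat{\mathbb{C}}$ and all its subsets (in particular $\partial\Omega$) carry the spherical metric. A domain is a connected open set. $B(x,r)$ and $\overline{B}(x,r)$ denote the open and closed metric balls. John domains: for a domain $\Omega \subset \hat{\mathbb{C}}$ and $z \in \Omega$, let $\delta_\Omega(z) = \mathrm{dist}(z,\partial\Omega)$. For an arc $\alpha$ and $z,z' \in \alpha$, $\alpha[z,z']$ denotes the closed sub-arc joining $z$ and $z'$. For $L \ge 1$, an arc $\alpha \subset \Omega$ with endpoints $z_0, z_1$ is an $L$-John arc with base-point $z_0$ and tip $z_1$ if $\mathrm{diam}(\alpha[z,z_1]) \le L\,\delta_\Omega(z)$ for every $z \in \alpha$. $\Omega$ is an $L$-John domain if there is $z_0 \in \Omega$ such that every $z \in \Omega$ can be joined to $z_0$ by an $L$-John arc with base-point $z_0$ and tip $z$. A metric space is doubling if there is a constant $D$ such that every ball of radius $r$ can be covered by at most $D$ balls of radius $r/2$. A discrete $\delta$-path in $(X,d)$ is a finite sequence $x_0,\dots,x_\ell$ of points of $X$ with $d(x_i,x_{i-1}) \le \delta$ for $1\le i\le \ell$; it is a path from $A$ to $B$ if $x_0\in A$ and $x_\ell\in B$. It intersects the $\delta'$-neighborhood of a set $K$ if $\mathrm{dist}(x_i,K)<\delta'$ for some $i$. Discrete UWS property: a doubling metric space $(X,d)$ has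 the discrete UWS property with constant $C\ge 1$ if for any $x\in X$ and $0<r<C^{-1}\mathrm{diam}(X)$, for every $0<\epsilon<1$, there is a finite set $K\subset B(x,2r)$, with $\#K\le C$, such that every discrete $\epsilon r$-path from $B(x,r)$ to $X\setminus\overline{B}(x,2r)$ intersects the $\epsilon r$-neighborhood of $K$. *)

(* Defs.v *)
From HB Require Import structures.
From mathcomp Require Import all_boot all_order all_algebra finmap.
From mathcomp Require Import ring lra.
From mathcomp Require Import complex.
From mathcomp Require Import all_classical all_reals all_analysis.

Set Implicit Arguments.
Unset Strict Implicit.
Unset Printing Implicit Defensive.

Import Order.TTheory GRing.Theory Num.Theory.
Import numFieldNormedType.Exports.

Local Open Scope classical_set_scope.
Local Open Scope ring_scope.

(* C together with the point at infinity [None].  This is an alias of [option]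
   so that the topology is the one induced by the metric declared below. *)
Definition riemann_sphere (R : realType) : Type := option R[i].

Section SphericalMetric.
Variable R : realType.
Implicit Types z w : riemann_sphere R.

HB.instance Definition _ :=
  Choice.copy (riemann_sphere R) (option R[i]).

(* Inverse stereographic projection onto the unit sphere of R^3, with infinity
   sent to the north pole. *)
Definition stereo z : R * R * R :=
  if z is Some (a +i* b)%C then
    let n := a ^+ 2 + b ^+ 2 in
    (2 * a / (1 + n), 2 * b / (1 + n), (n - 1) / (1 + n))
  else (0, 0, 1).

Definition dot3 (u v : R * R * R) : R :=
  u.1.1 * v.1.1 + u.1.2 * v.1.2 + u.2 * v.2.

(* The geodesic distance of the unit sphere, i.e. the length metric of
   2 |dz| / (1 + |z|^2). *)
Definition spherical_dist z w : R := acos (dot3 (stereo z) (stereo w)).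

Lemma normsq_gt0 (a b : R) : 0 < 1 + (a ^+ 2 + b ^+ 2).
Proof. by rewrite ltr_wpDr// addr_ge0// sqr_ge0. Qed.

Lemma dot3_stereo z : dot3 (stereo z) (stereo z) = 1.
Proof.
case: z => [[a b]|]; rewrite /dot3 /=; last by ring.
have /lt0r_neq0 n0 := normsq_gt0 a b.
by field.
Qed.

Lemma dot3C (u v : R * R * R) : dot3 u v = dot3 v u.
Proof. by rewrite /dot3; ring. Qed.

Lemma dot3_bound (u v : R * R * R) : dot3 u u = 1 -> dot3 v v = 1 -> -1 <= dot3 u v <= 1.
Proof.
case: u => [[a b] c]; case: v => [[a' b'] c']; rewrite /dot3 /= => hu hv.
have h1 := sqr_ge0 (a - a'); have h2 := sqr_ge0 (b - b').
have h3 := sqr_ge0 (c - c'); have h4 := sqr_ge0 (a + a').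
have h5 := sqr_ge0 (b + b'); have h6 := sqr_ge0 (c + c').
by apply/andP; split; nra.
Qed.

Lemma dot3_gram (u v w : R * R * R) :
  dot3 u u = 1 -> dot3 v v = 1 -> dot3 w w = 1 ->
  (dot3 u w - dot3 u v * dot3 v w) ^+ 2 <=
  (1 - dot3 u v ^+ 2) * (1 - dot3 v w ^+ 2).
Proof.
move=> hu hv hw; rewrite -subr_ge0.
suff -> : (1 - dot3 u v ^+ 2) * (1 - dot3 v w ^+ 2)
    - (dot3 u w - dot3 u v * dot3 v w) ^+ 2 =
  (u.1.1 * (v.1.2 * w.2 - v.2 * w.1.2) - u.1.2 * (v.1.1 * w.2 - v.2 * w.1.1)
   + u.2 * (v.1.1 * w.1.2 - v.1.2 * w.1.1)) ^+ 2 by exact: sqr_ge0.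
transitivity (dot3 u u * dot3 v v * dot3 w w
  + 2 * dot3 u v * dot3 v w * dot3 u w - dot3 u u * dot3 v w ^+ 2
  - dot3 v v * dot3 u w ^+ 2 - dot3 w w * dot3 u v ^+ 2).
  by rewrite hu hv hw; ring.
by rewrite /dot3; ring.
Qed.

Lemma stereo_inj : injective stereo.
Proof.
move=> [[a b]|] [[a' b']|] //=; last 2 first.
- have /lt0r_neq0 n0 := normsq_gt0 a b.
  case=> _ _ /(congr1 ( *%R^~ (1 + (a ^+ 2 + b ^+ 2)))) /=.
  by rewrite divfK// mul1r => ?; exfalso; lra.
- have /lt0r_neq0 n0 := normsq_gt0 a' b'.
  case=> _ _ /(congr1 ( *%R^~ (1 + (a' ^+ 2 + b' ^+ 2)))) /=.
  by rewrite divfK// mul1r => ?; exfalso; lra.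
have := normsq_gt0 a b; have := normsq_gt0 a' b'.
set n := a ^+ 2 + b ^+ 2; set n' := a' ^+ 2 + b' ^+ 2 => n'0 n0 [h1 h2 h3].
have ne := lt0r_neq0 n0; have ne' := lt0r_neq0 n'0.
have nn : n = n'.
  move: h3 => /(congr1 (fun x => x * (1 + n) * (1 + n'))).
  rewrite divfK// mulrAC divfK// => ?; lra.
move: h1 h2; rewrite nn => /(mulIf (invr_neq0 ne')) h1.
move=> /(mulIf (invr_neq0 ne')) h2.
by congr (Some (_ +i* _)%C); lra.
Qed.

Let dot_itv z w : dot3 (stereo z) (stereo w) \in `[-1, 1].
Proof. by rewrite in_itv /= dot3_bound// dot3_stereo. Qed.

Lemma spherical_distxx z : spherical_dist z z = 0.
Proof. by rewrite /spherical_dist dot3_stereo acos1. Qed.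

Lemma spherical_dist_sym z w : spherical_dist z w = spherical_dist w z.
Proof. by rewrite /spherical_dist dot3C. Qed.

Lemma spherical_dist_positivity z w : spherical_dist z w = 0 -> z = w.
Proof.
move=> /(congr1 cos); rewrite acosK ?dot_itv// cos0 => h.
apply: stereo_inj; move: h (dot3_stereo z) (dot3_stereo w).
move: (stereo z) (stereo w) => [[a b] c] [[a' b'] c']; rewrite /dot3 /=.
move=> h hz hw.
have s0 : (a - a') ^+ 2 + (b - b') ^+ 2 + (c - c') ^+ 2 = 0 by nra.
have h1 := sqr_ge0 (a - a'); have h2 := sqr_ge0 (b - b').
have h3 := sqr_ge0 (c - c').
have sq0 (x y : R) : (x - y) ^+ 2 <= 0 -> x = y.
  by move=> xy; apply/eqP; rewrite -subr_eq0 -sqrf_eq0 eq_le xy sqr_ge0.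
by congr (_, _, _); apply: sq0; lra.
Qed.

Lemma spherical_dist_triangle v z w :
  spherical_dist z w <= spherical_dist z v + spherical_dist v w.
Proof.
have acosb x y : 0 <= spherical_dist x y <= pi.
  have := dot_itv x y; rewrite in_itv /= => xy.
  by rewrite acos_ge0 ?acos_lepi.
have /andP[a0 api] := acosb z v; have /andP[b0 bpi] := acosb v w.
have /andP[c0 cpi] := acosb z w.
have [pile|ltpi] := leP pi (spherical_dist z v + spherical_dist v w).
  exact: le_trans pile.
rewrite leNgt; apply/negP => lt.
have : cos (spherical_dist z w) <
       cos (spherical_dist z v + spherical_dist v w).
  by rewrite ltr_cos// in_itv /= ?c0 ?cpi// addr_ge0//= ltW.
apply/negP; rewrite -leNgt cosD /spherical_dist.
have [[hzv hvw] hzw] := (dot_itv z v, dot_itv v w, dot_itv z w).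
have bnd (x : R) : x \in `[-1, 1] -> -1 <= x <= 1 by rewrite in_itv.
rewrite (acosK hzv) (acosK hvw) (acosK hzw) (sin_acos (bnd _ hzv)).
rewrite (sin_acos (bnd _ hvw)).
have hS (x : R) : x \in `[-1, 1] -> 0 <= 1 - x ^+ 2.
  by move=> /bnd /andP[? ?]; nra.
have := dot3_gram (dot3_stereo z) (dot3_stereo v) (dot3_stereo w).
rewrite lerBlDr -lerBlDl -sqrtrM ?hS// -ler_sqrt ?mulr_ge0 ?hS// sqrtr_sqr.
by apply: le_trans; rewrite distrC ler_norm.
Qed.

HB.instance Definition _ := @isMetric.Build R (riemann_sphere R)
  spherical_dist spherical_distxx spherical_dist_positivity
  spherical_dist_sym spherical_dist_triangle.

End SphericalMetric.

Definition boundary (T : topologicalType) (A : set T) : set T :=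
  closure A `\` interior A.

Section MetricNotions.
Variables (R : realType) (M : metricType R).
Implicit Types (A X : set M) (x y : M).

(* Extended-real valued: the distance to the empty set is +oo. *)
Definition set_dist x A : \bar R := ereal_inf [set (mdist x y)%:E | y in A].

(* The diameter of the empty set is -oo; it is only used for nonempty sets. *)
Definition diam A : \bar R :=
  ereal_sup [set (mdist x y)%:E | x in A & y in A].

(* [X] is doubling for the restricted metric: the centers of the balls are
   taken in [X], and the balls are intersected with [X]. *)
Definition doubling X : Prop :=
  exists D : nat, forall (x : M) (r : R), X x -> 0 < r ->
    exists2 K : {fset M}, (#|` K| <= D)%N &
      [set` K] `<=` X /\
      X `&` ball x r `<=` \bigcup_(y in [set` K]) ball y (r / 2).

Definition discrete_path X (delta : R) (x0 : M) (s : seq M) : Prop :=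
  {in x0 :: s, forall y, X y} /\ path (fun y z => mdist y z <= delta) x0 s.

Definition discrete_path_from_to X (delta : R) (A B : set M)
    (x0 : M) (s : seq M) : Prop :=
  [/\ discrete_path X delta x0 s, A x0 & B (last x0 s)].

Definition meets_nbhd (delta : R) (K : set M) (s : seq M) : Prop :=
  exists2 y, y \in s & (set_dist y K < delta%:E)%E.

(* As for [doubling], [X] carries the restricted metric. *)
Definition discrete_UWS (C : R) X : Prop :=
  [/\ 1 <= C, doubling X &
    forall (x : M) (r : R), X x -> 0 < r -> (r%:E < C^-1%:E * diam X)%E ->
    forall eps : R, 0 < eps < 1 ->
    exists K : {fset M},
      [/\ [set` K] `<=` X `&` ball x (2 * r), #|` K|%:R <= C &
        forall (x0 : M) (s : seq M),
          discrete_path_from_to X (eps * r)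
            (X `&` ball x r) (X `\` [set y | mdist x y <= 2 * r]) x0 s ->
          meets_nbhd (eps * r) [set` K] (x0 :: s)]].

End MetricNotions.

Section JohnDomains.
Variable R : realType.
Local Notation sphere := (riemann_sphere R).

Definition domain (Omega : set sphere) : Prop := open Omega /\ connected Omega.

Definition bdist (Omega : set sphere) (z : sphere) : \bar R :=
  set_dist z (boundary Omega).

(* [g] parametrizes an arc from [z0] to [z1] by the segment [a, b].  The case
   [a = b] is allowed, so that a point is an arc: it joins the base-point of a
   John domain to itself. *)
Definition arc_param (a b : R) (g : R -> sphere) (z0 z1 : sphere) : Prop :=
  [/\ a <= b, {within `[a, b], continuous g}, {in `[a, b] &, injective g},
      g a = z0 & g b = z1].

(* [g @` `[t, b]] is the sub-arc from [g t] to the tip [z1]. *)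
Definition John_arc (L : R) (Omega alpha : set sphere) (z0 z1 : sphere) :
    Prop :=
  exists a b (g : R -> sphere),
    [/\ arc_param a b g z0 z1, alpha = g @` `[a, b], alpha `<=` Omega &
      forall t, t \in `[a, b] ->
        (diam (g @` `[t, b]) <= L%:E * bdist Omega (g t))%E].

Definition John_domain (L : R) (Omega : set sphere) : Prop :=
  domain Omega /\
  exists2 z0, Omega z0 &
    forall z, Omega z -> exists alpha, John_arc L Omega alpha z0 z.

End JohnDomains.

(* Main.v *)
(** In a chart of the sphere around [x], consider a square lying between the
    images of [B(x, r)] and of the complement of [B(x, 2r)], and let
    [eta := eps * r].  Walk along a side of the square.  Points at distance at
    least [4 eta] from [Omega] are kept.  From a point closer to [Omega] a John
    arc leads, inside [Omega] and at distance from the boundary comparable with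
    the distance to its tip, to a point at distance at least [c * r] from the
    boundary.  Up to a small error only boundedly many such points exist, so one
    can jump through two John arcs from the first to the last point of the side
    whose arcs end at the same place.  The closed chain so obtained comes within
    a few [eta] of the boundary only near boundedly many tips, around which the
    cut set is placed.  Along a discrete path in the boundary that avoids the
    neighborhood of the cut set, the winding number of the chain is constant,
    whereas it is 1 in [B(x, r)] and 0 outside [B(x, 2r)]. *)

Require Import Defs.
From mathcomp Require Import all_boot all_order all_algebra finmap.
From mathcomp Require Import ring lra zify.
From mathcomp Require Import all_classical all_reals all_analysis.
Import Order.TTheory GRing.Theory Num.Theory.

Set Implicit Arguments.
Unset Strict Implicit.
Unset Printing Implicit Defensive.
Import numFieldNormedType.Exports.
Local Open Scope classical_set_scope.
Local Open Scope ring_scope.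

(** * Winding numbers of discrete chains *)

Section Winding.
Variable R : realType.
Implicit Types (u v w p q x y : R * R) (s : seq (R * R)).

Definition upper u : int := (0 <= u.2)%R%:Z.

(* The signed crossing of the positive horizontal axis by a short step. *)
Definition crossing u v : int :=
  if (0 < u.1) && (0 < v.1) then upper v - upper u else 0.

Lemma norm_pair_lt u e : `|u| < e -> `|u.1| < e /\ `|u.2| < e.
Proof. by rewrite prod_normE gt_max => /andP. Qed.

Lemma norm_pair_le u e : `|u.1| <= e -> `|u.2| <= e -> `|u| <= e.
Proof. by rewrite prod_normE ge_max => -> ->. Qed.

Lemma same_sign (a b : R) :
  `|a - b| < `|a| -> ((0 < b) = (0 < a)) * ((0 <= b) = (0 <= a)).
Proof.
by rewrite ltr_norml => /andP[]; case: (lerP 0 a) => a0;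
  [rewrite ger0_norm|rewrite ltr0_norm] => // *; split; lra.
Qed.

(* A step shorter than the distance from 0 keeps the sign of the largest
   coordinate, so that locally [crossing] is either 0 or a coboundary. *)
Lemma crossingD u v w :
  `|u - v| < `|u| -> `|u - w| < `|u| -> crossing u v + crossing v w = crossing u w.
Proof.
move=> /norm_pair_lt[/= uv1 uv2] /norm_pair_lt[/= uw1 uw2].
rewrite /crossing /upper.
move: uv1 uv2 uw1 uw2; rewrite prod_normE.
case: (leP `|u.1| `|u.2|) => _.
  move=> _ /same_sign[_ ->] _ /same_sign[_ ->]; rewrite subrr.
  by do 3 case: ifP.
move=> /same_sign[-> _] _ /same_sign[-> _] _; rewrite andbb.
by case: ifP => // _; ring.
Qed.

(** Signed crossings of the rightward horizontal ray from [x] by the chain [q :: s]. If the chain is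
    closed and its steps are short compared with the distance to [x], this is its winding number
    around [x]. *)
Fixpoint winding x q s : int :=
  if s is q' :: s' then crossing (q - x) (q' - x) + winding x q' s' else 0.

Lemma winding_cat x q s1 s2 :
  winding x q (s1 ++ s2) = winding x q s1 + winding x (last q s1) s2.
Proof. by elim: s1 q => [|q' s1 IH] q /=; rewrite ?add0r// IH addrA. Qed.

(** A discrete homotopy. Each step spans a quadrilateral between the chain seen from [x] and from
    [y]; the diagonal from [q - x] to [q' - y] cuts it into two triangles, [crossingD] applies to
    both, and the transversal terms telescope. *)
Lemma winding_moveD x y q s :
  path (fun q q' => (`|q - q'| + `|x - y| < `|q - x|)) q s ->
  `|x - y| < `|last q s - x| ->
  winding x q s + crossing (last q s - x) (last q s - y) =
  crossing (q - x) (q - y) + winding y q s.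
Proof.
elim: s q => [|q' s IH] q /=; first by rewrite addr0 add0r.
move=> /andP[qq' pq] xy; rewrite -addrA IH// addrA [RHS]addrA; congr +%R.
have dx a : a - x - (a - y) = y - x.
  by rewrite opprB addrC subrKA.
have xyN : `|y - x| = `|x - y| by rewrite distrC.
have qx : `|x - y| < `|q - x| by apply: le_lt_trans qq'; rewrite lerDr.
have step1 : `|q - x - (q' - x)| < `|q - x|.
  by rewrite opprB subrKA; apply: le_lt_trans qq'; rewrite lerDl.
have step2 : `|q - x - (q' - y)| < `|q - x|.
  apply: le_lt_trans qq'; rewrite -xyN opprB [y - q']addrC addrACA.
  by rewrite [- x + y]addrC ler_normD.
by rewrite !crossingD// dx xyN.
Qed.

Lemma winding_right x q s : {in q :: s, forall p, x.1 < p.1} ->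
  winding x q s = upper (last q s - x) - upper (q - x).
Proof.
elim: s q => [|q' s IH] q /= qs; first by rewrite subrr.
rewrite IH; last by move=> p ps; apply: qs; rewrite inE ps orbT.
rewrite /crossing !subr_gt0 !qs ?inE ?eqxx ?orbT//=; ring.
Qed.

Lemma winding_left x q s : {in q :: s, forall p, p.1 <= x.1} ->
  winding x q s = 0.
Proof.
elim: s q => [|q' s IH] q //= qs.
rewrite IH; last by move=> p ps; apply: qs; rewrite inE ps orbT.
by rewrite /crossing !subr_gt0 ltNge qs ?inE ?eqxx.
Qed.

Lemma winding_above x q s : {in q :: s, forall p, x.2 <= p.2} ->
  winding x q s = 0.
Proof.
elim: s q => [|q' s IH] q //= qs.
rewrite IH; last by move=> p ps; apply: qs; rewrite inE ps orbT.
rewrite /crossing /upper /= !subr_ge0 !qs ?inE ?eqxx ?orbT//= subrr.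
by case: ifP.
Qed.

Lemma winding_below x q s : {in q :: s, forall p, p.2 < x.2} ->
  winding x q s = 0.
Proof.
elim: s q => [|q' s IH] q //= qs.
rewrite IH; last by move=> p ps; apply: qs; rewrite inE ps orbT.
rewrite /crossing /upper /= !subr_ge0 !leNgt !qs ?inE ?eqxx ?orbT//= subrr.
by case: ifP.
Qed.

Lemma winding_closed_move x y q s : last q s = q ->
  path (fun q q' => (`|q - q'| + `|x - y| < `|q - x|)) q s ->
  `|x - y| < `|q - x| ->
  winding x q s = winding y q s.
Proof.
move=> ls pq xy; have := winding_moveD pq; rewrite ls => /(_ xy).
by rewrite addrC => /addrI.
Qed.

(** The norm is the maximum norm, so some coordinate of [x] has absolute value at least [a], and the
    whole chain lies to one side of [x] in that coordinate. *)
Lemma winding_outside x q s (a : R) : last q s = q ->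
  {in q :: s, forall p, `|p| < a} -> a <= `|x| -> winding x q s = 0.
Proof.
move=> ls qs; rewrite prod_normE le_max.
have qs1 p : p \in q :: s -> [/\ - a < p.1, p.1 < a, - a < p.2 & p.2 < a].
  by move=> /qs /norm_pair_lt[]; rewrite !ltr_norml => /andP[? ?] /andP[].
move=> /orP[]; case: ler0P => x0 ax.
- by rewrite winding_right ?ls ?subrr// => p /qs1[]; lra.
- by apply: winding_left => p /qs1[]; lra.
- by apply: winding_above => p /qs1[]; lra.
- by apply: winding_below => p /qs1[]; lra.
Qed.

(* [s1] to [s4] follow the sides of the square of half side [h] around 0, up to [e]. *)
Lemma winding_inside x q s1 s2 s3 s4 (h e : R) : `|x| < h - e ->
  let q2 := last q s1 in let q3 := last q2 s2 in let q4 := last q3 s3 in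
  last q4 s4 = q ->
  {in q :: s1, forall p, `|p.1 - h| <= e} ->
  {in q2 :: s2, forall p, `|p.2 - h| <= e} ->
  {in q3 :: s3, forall p, `|p.1 + h| <= e} ->
  {in q4 :: s4, forall p, `|p.2 + h| <= e} ->
  winding x q (s1 ++ s2 ++ s3 ++ s4) = 1.
Proof.
move=> /norm_pair_lt[]; rewrite !ltr_norml => /andP[x1 x1'] /andP[x2 x2'] /=.
move=> lq r1 r2 r3 r4.
(* Only the right side meets the ray from [x]. It starts below [x] and ends above, as its endpoints
   also belong to the bottom and top sides, so it contributes 1. *)
rewrite 3!winding_cat winding_right; last first.
  by move=> p /r1; rewrite ler_norml => /andP[]; lra.
rewrite winding_above; last by move=> p /r2; rewrite ler_norml => /andP[]; lra.
rewrite winding_left; last by move=> p /r3; rewrite ler_norml => /andP[]; lra.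
rewrite winding_below; last by move=> p /r4; rewrite ler_norml => /andP[]; lra.
have := r2 _ (mem_head _ _); have := r4 _ (mem_last _ _); rewrite lq.
rewrite !ler_norml => /andP[_ q2] /andP[p2 _]; rewrite !addr0 /upper /=.
rewrite !subr_ge0 (_ : x.2 <= (last q s1).2 = true); last by apply/idP; lra.
by rewrite (_ : x.2 <= q.2 = false)//; apply/negbTE; rewrite -ltNge; lra.
Qed.

End Winding.

(** * Spherical distance and chords *)

Section SphereGeometry.
Variable R : realType.
Local Notation sphere := (riemann_sphere R).
Implicit Types (t : R) (y z : sphere).

Lemma sin_mean t : 0 <= t -> exists2 c, 0 <= c <= t & sin t = cos c * t.
Proof.
move=> t0; have [|c] := @MVT_segment R sin cos 0 t t0.
- by apply: continuous_subspaceT; exact: continuous_sin.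
- by rewrite in_itv /= sin0 !subr0 => ct sE; exists c.
Qed.

Lemma sin_le_id t : 0 <= t -> sin t <= t.
Proof.
by move=> t0; have [c _ ->] := sin_mean t0; rewrite ler_piMl// cos_le1.
Qed.

Lemma cos_half t : cos t = 1 - 2 * sin (t / 2) ^+ 2.
Proof.
have := cos2Dsin2 (t / 2); have := @cosD R (t / 2) (t / 2).
by rewrite -splitr => -> ?; nra.
Qed.

Lemma cos_ge t : 0 <= t <= 1 -> 1 - t ^+ 2 / 2 <= cos t.
Proof.
move=> /andP[t0 t1]; rewrite cos_half.
have h0 : 0 <= t / 2 by lra.
have h1 := sin_le_id h0.
have h2 : 0 <= sin (t / 2) by apply: sin_ge0_pi; have := @pi_ge2 R; lra.
by nra.
Qed.

Lemma sin_ge t : 0 <= t <= 10^-1 -> 99 / 100 * t <= sin t.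
Proof.
move=> /andP[t0 t1]; have [c /andP[c0 ct] ->] := sin_mean t0.
have c1 : 0 <= c <= 1 by lra.
by have := cos_ge c1; nra.
Qed.

Lemma mdist_sphereE y z : mdist y z = acos (dot3 (stereo y) (stereo z)).
Proof. by []. Qed.

Lemma dot3_stereo_bound y z : -1 <= dot3 (stereo y) (stereo z) <= 1.
Proof. by apply: dot3_bound; exact: dot3_stereo. Qed.

Lemma cos_mdist y z : cos (mdist y z) = dot3 (stereo y) (stereo z).
Proof. by rewrite mdist_sphereE acosK// in_itv dot3_stereo_bound. Qed.

Lemma mdist_lepi y z : mdist y z <= pi.
Proof. by rewrite mdist_sphereE acos_lepi// dot3_stereo_bound. Qed.

Lemma chord_mdist y z :
  ((stereo y).1.1 - (stereo z).1.1) ^+ 2 + ((stereo y).1.2 - (stereo z).1.2) ^+ 2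
    + ((stereo y).2 - (stereo z).2) ^+ 2 = 4 * sin (mdist y z / 2) ^+ 2.
Proof.
have := cos_half (mdist y z); rewrite cos_mdist.
have := dot3_stereo y; have := dot3_stereo z.
by rewrite /dot3; lra.
Qed.

Lemma sin_half_mdist_ge0 y z : 0 <= sin (mdist y z / 2).
Proof.
by apply: sin_ge0_pi; have := mdist_ge0 y z; have := mdist_lepi y z; lra.
Qed.

Lemma dot3_lipschitz (e : R * R * R) y z : dot3 e e = 1 ->
  `|dot3 e (stereo y) - dot3 e (stereo z)| <= mdist y z.
Proof.
move=> e1; have d0 := mdist_ge0 y z; have h0 : 0 <= mdist y z / 2 by lra.
rewrite -ler_sqr ?nnegrE// real_normK ?num_real//.
have := chord_mdist y z; have := sin_half_mdist_ge0 y z; have := sin_le_id h0.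
move: e1; rewrite /dot3; move: (stereo y) (stereo z) (sin _) e.
move=> [[a b] c] [[a' b'] c'] s [[u v] w] /=.
move=> e1 s1 s0 cE.
have s2 : 4 * s ^+ 2 <= mdist y z ^+ 2 by nra.
apply: le_trans s2; rewrite -cE.
have -> : u * a + v * b + w * c - (u * a' + v * b' + w * c') =
  u * (a - a') + v * (b - b') + w * (c - c') by ring.
move: (a - a') (b - b') (c - c') => A B C.
rewrite -[leRHS]mul1r -e1 -subr_ge0.
(* Lagrange's identity, giving Cauchy-Schwarz; the chord has already been bounded by the arc. *)
have -> : (u * u + v * v + w * w) * (A ^+ 2 + B ^+ 2 + C ^+ 2) -
   (u * A + v * B + w * C) ^+ 2 =
   (u * B - v * A) ^+ 2 + (u * C - w * A) ^+ 2 + (v * C - w * B) ^+ 2 by ring.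
by rewrite !addr_ge0 ?sqr_ge0.
Qed.

(** The chord is at most [sqrt 3 * h], so [sin (mdist y z / 2) <= h]. For small distances the sine
    is almost linear; otherwise [h] is at least [99 / 1000], and [50 * h] exceeds [pi]. *)
Lemma mdist_le_chord y z (h : R) :
  `|(stereo y).1.1 - (stereo z).1.1| <= h ->
  `|(stereo y).1.2 - (stereo z).1.2| <= h ->
  `|(stereo y).2 - (stereo z).2| <= h -> mdist y z <= 50 * h.
Proof.
have := chord_mdist y z; move: (_ - _) (_ - _) (_ - _) => a b c abc ah bh ch.
have h0 : 0 <= h by apply: le_trans ah.
have s0 := sin_half_mdist_ge0 y z; have d0 := mdist_ge0 y z.
have sh : sin (mdist y z / 2) <= h.
  have sq u : `|u| <= h -> u ^+ 2 <= h ^+ 2.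
    by move=> uh; rewrite -[u ^+ 2]real_normK ?num_real// ler_sqr ?nnegrE.
  have {}ah := sq _ ah; have {}bh := sq _ bh; have {}ch := sq _ ch.
  by nra.
case: (lerP (mdist y z / 2) 10^-1) => d1.
  have := @sin_ge (mdist y z / 2); lra.
have pi4 : pi < 4 :> R by have := @pihalf_lt2 R; lra.
have := mdist_lepi y z; have := @pi_ge2 R => pi2 dpi.
have : cos (mdist y z) < cos (5^-1 : R).
  by rewrite ltr_cos ?in_itv /=; lra.
rewrite 2!cos_half.
have : 99 / 100 * 10^-1 <= sin (10^-1 : R) by apply: sin_ge; lra.
have -> : 5^-1 / 2 = 10^-1 :> R by lra.
by nra.
Qed.

(** The cube of half side [r] around [stereo x] is cut into cubes of side [lam * r / 50]. About
    [100 / lam] intervals per axis suffice, so the set of cells is independent of [x] and [r]. *)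
Lemma sphere_grid (lam : R) : 0 < lam ->
  exists F : finType, forall (x : sphere) (r : R), 0 < r ->
    exists f : sphere -> F, forall y z, mdist x y <= r -> mdist x z <= r ->
      f y = f z -> mdist y z <= lam * r.
Proof.
move=> lam0; pose m := Num.truncn (100 / lam).
exists ('I_m.+1 * 'I_m.+1 * 'I_m.+1)%type => x r r0.
pose h := lam * r / 50; have h0 : 0 < h by rewrite /h; nra.
pose cell (a b : R) : 'I_m.+1 := inord (Num.truncn ((a - b + r) / h)).
have cellP (a a' b : R) : `|b - a| <= r -> `|b - a'| <= r ->
    cell a b = cell a' b -> `|a - a'| <= h.
  have itv c : `|b - c| <= r ->
      0 <= (c - b + r) / h /\ (Num.truncn ((c - b + r) / h) < m.+1)%N.
    rewrite ler_norml => /andP[c1 c2].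
    have c0 : 0 <= (c - b + r) / h by rewrite divr_ge0; lra.
    split=> //; rewrite ltnS; apply: le_truncn.
    rewrite ler_pdivrMr// /h.
    have -> : 100 / lam * (lam * r / 50) = 2 * r by field; lra.
    by lra.
  move=> /itv[a0 am] /itv[a'0 a'm] /(congr1 val) /=; rewrite /cell !inordK// => tE.
  have /andP[] := truncn_itv a0; have /andP[] := truncn_itv a'0.
  rewrite tE => t1 t2 t3 t4; rewrite -[h]mul1r -ler_pdivrMr//.
  rewrite -[X in _ / X](gtr0_norm h0) -normf_div.
  have -> : (a - a') / h = (a - b + r) / h - (a' - b + r) / h.
    by rewrite -mulrBl; congr (_ / _); ring.
  move: t1 t2 t3 t4; rewrite -natr1 ler_norml; lra.
exists (fun y => (cell (stereo y).1.1 (stereo x).1.1,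
  cell (stereo y).1.2 (stereo x).1.2, cell (stereo y).2 (stereo x).2)).
have pr1 (y z : sphere) : `|(stereo y).1.1 - (stereo z).1.1| <= mdist y z.
  have := @dot3_lipschitz (1, 0, 0) y z.
  rewrite /dot3 /= !mul1r !mul0r !addr0; apply; ring.
have pr2 (y z : sphere) : `|(stereo y).1.2 - (stereo z).1.2| <= mdist y z.
  have := @dot3_lipschitz (0, 1, 0) y z.
  rewrite /dot3 /= !mul1r !mul0r !addr0 !add0r; apply; ring.
have pr3 (y z : sphere) : `|(stereo y).2 - (stereo z).2| <= mdist y z.
  have := @dot3_lipschitz (0, 0, 1) y z.
  rewrite /dot3 /= !mul1r !mul0r !add0r; apply; ring.
move=> y z xy xz [] c1 c2 c3.
have -> : lam * r = 50 * h by rewrite /h; lra.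
by apply: mdist_le_chord; [move: c1|move: c2|move: c3]; apply: cellP;
  first [exact: le_trans (pr1 _ _) _|exact: le_trans (pr2 _ _) _
        |exact: le_trans (pr3 _ _) _].
Qed.
End SphereGeometry.

(** * Orthogonal projection to a tangent plane as a chart *)

Section Chart.
Variable R : realType.
Local Notation sphere := (riemann_sphere R).
Implicit Types (y z : sphere).

(** The vectors are the images of the first two basis vectors under the rotation taking the north
    pole to [n] along a great circle. The formula divides by [1 + n.2], hence the reduction to the
    upper half space. *)
Lemma orthonormal_frame (n : R * R * R) : dot3 n n = 1 ->
  exists e1 e2, [/\ dot3 e1 e1 = 1, dot3 e2 e2 = 1 &
    forall v, dot3 e1 v ^+ 2 + dot3 e2 v ^+ 2 + dot3 n v ^+ 2 = dot3 v v].
Proof.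
wlog n0 : n / 0 <= n.2 => [wl n1|].
  case: (lerP 0 n.2) => [/wl|n0]; first exact.
  have [||e1 [e2 [h1 h2 h]]] := wl (- n.1.1, - n.1.2, - n.2) => /=.
  - by lra.
  - by move: n1; rewrite /dot3 /= !mulrNN.
  exists e1, e2; split=> // v; rewrite -h; congr (_ + _).
  by rewrite /dot3 /=; ring.
case: n n0 => [[a b] c] /= c0; rewrite {1}/dot3 /= => n1.
have c1 : 1 + c != 0 by rewrite gt_eqF//; lra.
pose k := (1 + c)^-1; have kE : k * (1 + c) = 1 by rewrite mulVf.
exists (1 - a ^+ 2 * k, - (a * b) * k, - a).
exists (- (a * b) * k, 1 - b ^+ 2 * k, - b).
have cE : a * a + b * b = (1 - c) * (1 + c) by lra.
split => [||[[u v] w]]; rewrite /dot3 /=.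
- transitivity (1 - 2 * a ^+ 2 * k + a ^+ 2 * k ^+ 2 * (a * a + b * b) + a ^+ 2).
    by ring.
  rewrite cE; transitivity (1 + a ^+ 2 * (1 - k * (1 + c)) +
    a ^+ 2 * k * (1 - c) * (k * (1 + c) - 1)); first by ring.
  by rewrite kE; ring.
- transitivity (1 - 2 * b ^+ 2 * k + b ^+ 2 * k ^+ 2 * (a * a + b * b) + b ^+ 2).
    by ring.
  rewrite cE; transitivity (1 + b ^+ 2 * (1 - k * (1 + c)) +
    b ^+ 2 * k * (1 - c) * (k * (1 + c) - 1)); first by ring.
  by rewrite kE; ring.
pose t := (a * u + b * v) * k + w.
have tE : a * u + b * v = (t - w) * (1 + c).
  by rewrite /t addrK -mulrA kE mulr1.
transitivity ((u - a * t) ^+ 2 + (v - b * t) ^+ 2 + (a * u + b * v + c * w) ^+ 2).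
  by rewrite /t; ring.
transitivity (u ^+ 2 + v ^+ 2 - 2 * t * (a * u + b * v) +
  t ^+ 2 * (a * a + b * b) + (a * u + b * v + c * w) ^+ 2); first by ring.
by rewrite tE cE; ring.
Qed.

(** [Phi] projects the sphere orthogonally to the tangent plane at [x]; the lost coordinate is
    [cos (mdist x y)], which varies slowly near [x]. The sharper factor [2 / 3] from the centre
    leaves room for a square between the images of the two balls. *)
Lemma sphere_chart (x : sphere) : exists Phi : sphere -> R * R,
  [/\ forall y z, `|Phi y - Phi z| <= mdist y z,
      forall y z, mdist x y <= 10^-1 -> mdist x z <= 10^-1 ->
        mdist y z <= 2 * `|Phi y - Phi z|,
      Phi x = 0 &
      forall y, mdist x y <= 10^-1 -> 2 / 3 * mdist x y <= `|Phi y|].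
Proof.
have [e1 [e2 [n1 n2 nE]]] := orthonormal_frame (dot3_stereo x).
pose Phi y := (dot3 e1 (stereo y), dot3 e2 (stereo y)).
have cE y : (Phi y).1 ^+ 2 + (Phi y).2 ^+ 2 + cos (mdist x y) ^+ 2 = 1.
  by rewrite cos_mdist nE dot3_stereo.
have x0 : Phi x = 0.
  have := cE x; rewrite mdistxx cos0; case: (Phi x) => p q /= pq.
  have := sqr_ge0 p; have := sqr_ge0 q => p0 q0.
  by congr (_, _); apply/eqP; rewrite -sqrf_eq0 eq_le sqr_ge0 andbT; lra.
have lip y z : `|Phi y - Phi z| <= mdist y z.
  by apply: norm_pair_le; exact: dot3_lipschitz.
have lipx y : `|Phi y| <= mdist x y by rewrite metric_sym -[Phi y]subr0 -x0.
have mle (u : R * R) : `|u.1| <= `|u| /\ `|u.2| <= `|u|.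
  by rewrite prod_normE !le_max !lexx orbT.
exists Phi; split=> //.
- move=> y z xy xz.
  have d0 := mdist_ge0 y z; have dyz := metric_triangle y x z.
  rewrite [X in _ <= X + _]metric_sym in dyz.
  have h : 99 / 100 * (mdist y z / 2) <= sin (mdist y z / 2).
    by apply: sin_ge; apply/andP; split; lra.
  have cy : 99 / 100 <= cos (mdist x y).
    have yI : 0 <= mdist x y <= 1 by rewrite mdist_ge0; lra.
    by have := cos_ge yI; have := mdist_ge0 x y; nra.
  have cz : 99 / 100 <= cos (mdist x z).
    have zI : 0 <= mdist x z <= 1 by rewrite mdist_ge0; lra.
    by have := cos_ge zI; have := mdist_ge0 x z; nra.
  have chord : ((Phi y).1 - (Phi z).1) ^+ 2 + ((Phi y).2 - (Phi z).2) ^+ 2 +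
      (cos (mdist x y) - cos (mdist x z)) ^+ 2 = 4 * sin (mdist y z / 2) ^+ 2.
    rewrite -chord_mdist.
    pose v := ((stereo y).1.1 - (stereo z).1.1, (stereo y).1.2 - (stereo z).1.2,
      (stereo y).2 - (stereo z).2).
    have := nE v; rewrite !cos_mdist /dot3 /= => vE.
    by rewrite !expr2 -vE /Phi /dot3 /=; ring.
  pose m := `|Phi y - Phi z|; have m0 : 0 <= m by exact: normr_ge0.
  have m1 : `|(Phi y).1 - (Phi z).1| <= m := (mle (Phi y - Phi z)).1.
  have m2 : `|(Phi y).2 - (Phi z).2| <= m := (mle (Phi y - Phi z)).2.
  have y1 := le_trans (mle (Phi y)).1 (le_trans (lipx y) xy).
  have y2 := le_trans (mle (Phi y)).2 (le_trans (lipx y) xy).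
  have z1 := le_trans (mle (Phi z)).1 (le_trans (lipx z) xz).
  have z2 := le_trans (mle (Phi z)).2 (le_trans (lipx z) xz).
  have yE := cE y; have zE := cE z.
  rewrite -/m; move: (cos (mdist x y)) (cos (mdist x z)) (sin _) m m0 (Phi y) (Phi z)
    cy cz h chord m1 m2 y1 y2 z1 z2 yE zE
    => Y Z S m m0 [a b] [a' b'] /= Y1 Z1 Sd chord m1 m2 y1 y2 z1 z2 yE zE.
  have small (k l : R) : `|k| <= m -> `|l| <= 2 / 10 -> `|k * l| <= 2 / 10 * m.
    by move=> km l2; rewrite normrM mulrC ler_pM.
  have add10 (k l : R) : `|k| <= 10^-1 -> `|l| <= 10^-1 -> `|k + l| <= 2 / 10.
    by move=> k1 l1; apply: le_trans (ler_normD _ _) _; lra.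
  have := small _ _ m1 (add10 _ _ y1 z1); have := small _ _ m2 (add10 _ _ y2 z2).
  rewrite !ler_norml => /andP[A1 A2] /andP[B1 B2].
  (* Difference of the two unit sphere equations. Since [Y + Z] is near 2 and the planar coordinates
     are small, [Y - Z] is a small multiple of [m]. *)
  have YZ : (Y - Z) * (Y + Z) = - ((a - a') * (a + a') + (b - b') * (b + b')) by lra.
  have YZ1 : Y - Z <= 21 / 100 * m by nra.
  have YZ2 : - (21 / 100 * m) <= Y - Z by nra.
  have sq (u v : R) : 0 <= v -> `|u| <= v -> u ^+ 2 <= v ^+ 2.
    by move=> v0 uv; rewrite -[u ^+ 2]real_normK ?num_real// ler_sqr ?nnegrE.
  have := sq _ _ m0 m1; have := sq _ _ m0 m2.
  have : (Y - Z) ^+ 2 <= (21 / 100 * m) ^+ 2.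
    by apply: sq; [lra|rewrite ler_norml YZ1 YZ2].
  move=> c1 c2 c3; have c4 : 4 * S ^+ 2 <= 205 / 100 * m ^+ 2.
    by rewrite -chord; have := sqr_ge0 m; move: c1 c2 c3; clear; lra.
  move: (mdist y z) d0 Sd c4 m0; clear=> d d0 Sd c4 m0.
  rewrite -ler_sqr ?nnegrE//; last by lra.
  have : (99 / 100 * (d / 2)) ^+ 2 <= S ^+ 2 by rewrite ler_sqr ?nnegrE; lra.
  by have := sqr_ge0 d; have := sqr_ge0 m; lra.
- move=> y xy.
  have d0 := mdist_ge0 x y.
  have h : 99 / 100 * mdist x y <= sin (mdist x y) by apply: sin_ge; rewrite d0.
  have [m1 m2] := mle (Phi y); have yE := cE y; have csE := cos2Dsin2 (mdist x y).
  have sq (u v : R) : `|u| <= v -> u ^+ 2 <= v ^+ 2.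
    move=> uv; rewrite -[u ^+ 2]real_normK ?num_real// ler_sqr ?nnegrE//.
    by apply: le_trans uv.
  have := sq _ _ m1; have := sq _ _ m2 => s1 s2.
  have s3 : (99 / 100 * mdist x y) ^+ 2 <= sin (mdist x y) ^+ 2.
    by rewrite ler_sqr ?nnegrE; lra.
  by rewrite -ler_sqr ?nnegrE//; [have := sqr_ge0 (mdist x y); lra|lra].
Qed.
End Chart.

(** * Chains and nets *)

Section MetricLemmas.
Variables (R : realType) (M : metricType R).
Implicit Types (x y z : M) (X : set M).

(** The points of [X] reachable from [a] by such chains form a nonempty subset that is both open and
    closed in [X]. *)
Lemma connected_chain X (e : R) a b : 0 < e -> connected X -> X a -> X b ->
  exists s, [/\ path (fun y z => mdist y z <= e) a s, last a s = b &
    {in a :: s, forall y, X y}].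
Proof.
move=> e0 cX Xa Xb.
pose B := [set z | X z /\ exists s,
  [/\ path (fun y z => mdist y z <= e) a s, last a s = z &
   {in a :: s, forall y, X y}]].
have Ba : B a by split=> //; exists [::]; split=> // y; rewrite inE => /eqP ->.
have Bext y z : B y -> X z -> mdist y z <= e -> B z.
  move=> [_ [s [ps ls sX]]] Xz yz; split=> //; exists (rcons s z); split.
  - by rewrite rcons_path ps ls.
  - by rewrite last_rcons.
  - by move=> t; rewrite -rcons_cons mem_rcons inE => /predU1P[->//|/sX].
have near y : (ball y e)° y by apply: nbhsx_ballx.
have inball y z : (ball y e)° z -> mdist y z <= e.
  by move=> /interior_subset; rewrite ballEmdist /= => /ltW.
suff BE : B = X by have [] : B b by rewrite BE.
apply: cX; first by exists a.
- exists (\bigcup_(y in B) (ball y e)°).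
    by apply: bigcup_open => y _; exact: open_interior.
  apply/seteqP; split => [z Bz|z [Xz [y By /inball]]]; last exact: Bext.
  by split; [case: Bz|exists z].
- exists (~` \bigcup_(y in X `\` B) (ball y e)°).
    by apply: open_closedC; apply: bigcup_open => y _; exact: open_interior.
  apply/seteqP; split => [z Bz|z [Xz nz]].
    split=> [|[y [Xy nBy] /inball]]; first by case: Bz.
    by rewrite metric_sym => yz; apply: nBy; exact: Bext yz.
  by apply: contrapT => nBz; apply: nz; exists z.
Qed.

Lemma closure_mdist X x (e : R) : closure X x -> 0 < e ->
  exists2 u, X u & mdist x u < e.
Proof.
move=> cX e0; have [u [Xu]] := cX _ (nbhsx_ballx x e e0).
by rewrite ballEmdist; exists u.
Qed.

(** The chain is stopped at its first point at distance at least [rho] from [u]; the last step may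
    overshoot by [eta]. *)
Lemma chain_exit (eta rho : R) (u v : M) s : 0 < eta ->
  mdist u v <= rho + eta -> path (fun y z => mdist y z <= eta) v s ->
  exists s', [/\ path (fun y z => mdist y z <= eta) v s', {subset v :: s' <= v :: s},
    {in v :: s', forall y, mdist u y <= rho + eta} &
    rho <= mdist u (last v s') \/ last v s' = last v s].
Proof.
move=> eta0; elim: s v => [|v' s IH] v uv /=.
  move=> _; exists [::]; split=> //; last by right.
  by move=> y; rewrite inE => /eqP ->.
move=> /andP[vv' ps]; have [ur|ur] := leP rho (mdist u v).
  exists [::]; split=> //; last by left.
    by move=> y; rewrite !inE => ->.
  by move=> y; rewrite inE => /eqP ->.
have [|s' [p1 sub bd e]] := IH v' _ ps.
  by have := metric_triangle u v v'; lra.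
exists (v' :: s'); split=> //=.
- by rewrite vv'.
- by move=> y; rewrite inE => /predU1P[->|/sub ys]; rewrite inE ?eqxx// ys orbT.
- by move=> y; rewrite inE => /predU1P[->|/bd].
Qed.

End MetricLemmas.

Lemma finite_fibers_choice (T : choiceType) (F : finType) (f : T -> F) (X : set T) :
  exists s : seq T, [/\ (size s <= #|F|)%N, {in s, forall y, X y} &
    forall y, X y -> exists2 k, k \in s & f k = f y].
Proof.
pose g c : option T :=
  if pselect (exists y, X y /\ f y = c) is left h then Some (sval (cid h)) else None.
have gP c y : g c = Some y -> X y /\ f y = c.
  by rewrite /g; case: pselect => // h [<-]; case: (cid h).
exists (pmap g (enum F)); split.
- by rewrite size_pmap cardE; exact: count_size.
- by move=> y; rewrite mem_pmap => /mapP[c _ /esym/gP[]].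
- move=> y Xy; case gy: (g (f y)) => [k|]; last first.
    by move: gy; rewrite /g; case: pselect => // -[]; exists y.
  have [_ kE] := gP _ _ gy; exists k => //.
  by rewrite mem_pmap -gy map_f// mem_enum.
Qed.

Section SphereNets.
Variable R : realType.
Local Notation sphere := (riemann_sphere R).

(** One representative per grid cell met by [X]. The representatives lie in [X], as the points of a
    cut set must. *)
Lemma sphere_net (lam : R) : 0 < lam ->
  exists N : nat, forall (x : sphere) (r : R) (X : set sphere), 0 < r ->
    (forall y, X y -> mdist x y <= r) ->
    exists s : seq sphere, [/\ (size s <= N)%N, {in s, forall y, X y} &
      forall y, X y -> exists2 k, k \in s & mdist k y <= lam * r].
Proof.
move=> lam0; have [F fP] := sphere_grid lam0; exists #|F| => x r X r0 Xr.
have [f fE] := fP x r r0; have [s [sF sX sk]] := finite_fibers_choice f X.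
exists s; split=> // y Xy; have [k ks kE] := sk y Xy.
by exists k => //; apply: fE => //; apply: Xr => //; exact: sX.
Qed.

Lemma sphere_doubling (X : set sphere) : doubling X.
Proof.
have [|N NP] := @sphere_net 4^-1; first by lra.
exists N => x r Xx r0.
have [y [_]|s [sN sX sk]] := NP x r (X `&` ball x r) r0.
  by rewrite ballEmdist => /ltW.
exists [fset y in s]%fset; first by rewrite card_fseq (leq_trans (size_undup _)).
split=> [y /=|y /sk[k ks ky]]; first by rewrite inE => /sX[].
by exists k; rewrite /= ?inE// ballEmdist /=; lra.
Qed.

End SphereNets.

(** * A chain crossed only near the tips of John arcs *)

Section CrossingChains.
Variables (R : realType) (M : metricType R).
(** [J] stands for the boundary of [Omega], [Phi] for the chart at [x], and [w u] for the end of a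
    truncated John arc with tip [u], called a carrot below. [delta] bounds the distance from these
    ends to [J], and [cell] colours them. *)
Variables (Omega J : set M) (x : M) (L r eta delta : R).
Variables (F : finType) (Phi : M -> R * R) (w : M -> M) (cell : M -> F).
Implicit Types (y z u : M) (p q : R * R) (T : seq M) (Q : set (R * R)).

Hypothesis L_ge1 : 1 <= L.
Hypothesis eta_gt0 : 0 < eta.
Hypothesis eta_r : 1000 * eta <= r.
Hypothesis eta_delta : 10 * eta <= delta.
Hypothesis Phi_lip : forall y z, `|Phi y - Phi z| <= mdist y z.
Hypothesis Phi_colip : forall y z, mdist x y <= 4 * r -> mdist x z <= 4 * r ->
  mdist y z <= 2 * `|Phi y - Phi z|.
Hypothesis Omega_dense : forall y (e : R), J y -> 0 < e ->
  exists2 u, Omega u & mdist y u < e.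
Hypothesis carrot : forall u, Omega u -> exists s,
  [/\ path (fun y z => mdist y z <= eta) u s, last u s = w u &
    {in u :: s, forall y, mdist u y <= r / 50 /\
      forall z, J z -> mdist u y <= L * mdist y z}].
Hypothesis carrot_end : forall u z, Omega u -> J z -> delta <= mdist (w u) z.
Hypothesis cellP : forall y z, mdist x y <= 4 * r -> mdist x z <= 4 * r ->
  cell y = cell z -> mdist y z <= delta / 10.

(* Points of [J] that a discrete path missing the neighbourhood of the cut set
   may visit, when the cut set is dense at scale [eta] around the points of [T]. *)
Definition free T y : Prop :=
  [/\ J y, mdist x y <= 19 / 10 * r &
    {in T, forall t, 20 * (1 + L) * eta <= mdist t y}].

(** The margin [eta] is the step of a discrete path in [J], as [winding_closed_move] requires. The
    bound is asked at both ends so that chains can be reversed. *)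
Definition short T q q' : Prop := forall y, free T y ->
  `|q - q'| + eta < `|q - Phi y| /\ `|q - q'| + eta < `|q' - Phi y|.

Inductive linked T Q : R * R -> R * R -> Prop :=
| Linked0 q : Q q -> linked T Q q q
| LinkedS q1 q2 q3 : Q q1 -> short T q1 q2 -> linked T Q q2 q3 -> linked T Q q1 q3.

Lemma linked_trans T Q q1 q2 q3 :
  linked T Q q1 q2 -> linked T Q q2 q3 -> linked T Q q1 q3.
Proof.
by elim=> // a b c Qa ab _ IH /IH; exact: LinkedS.
Qed.

Lemma shortC T q q' : short T q q' -> short T q' q.
Proof. by move=> qq' y /qq'[]; rewrite distrC. Qed.

Lemma linked1 T Q q q' : Q q -> Q q' -> short T q q' -> linked T Q q q'.
Proof. by move=> Qq Qq' qq'; apply: LinkedS qq' _ => //; exact: Linked0. Qed.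

Lemma linkedC T Q q q' : linked T Q q q' -> linked T Q q' q.
Proof.
elim=> [a Qa|a b c Qa ab bc IH]; first exact: Linked0.
apply: linked_trans IH _; apply: linked1 (shortC ab) => //.
by case: bc.
Qed.

Lemma free_sub T T' y : {subset T <= T'} -> free T' y -> free T y.
Proof. by move=> TT' [Jy xy far]; split=> // t /TT'; exact: far. Qed.

Lemma linked_sub T T' Q q q' : {subset T <= T'} ->
  linked T Q q q' -> linked T' Q q q'.
Proof.
move=> TT'; elim=> [a Qa|a b c Qa ab _ IH]; first exact: Linked0.
by apply: LinkedS IH => // y /(free_sub TT'); exact: ab.
Qed.

Lemma linked_path T Q q q' : linked T Q q q' ->
  exists s, [/\ path (fun a b => `[< short T a b >]) q s, last q s = q' &
    {in q :: s, forall p, Q p}].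
Proof.
elim=> [a Qa|a b c Qa ab _ [s [ps ls sQ]]].
  by exists [::]; split=> // y; rewrite inE => /eqP ->.
exists (b :: s); split=> /=; first by rewrite ps andbT; apply/asboolP.
- by [].
- by move=> y; rewrite inE => /predU1P[->|/sQ].
Qed.

Lemma free_norm T u y : mdist x u <= 4 * r -> free T y ->
  mdist u y <= 2 * `|Phi u - Phi y|.
Proof.
by move=> xu [_ xy _]; apply: Phi_colip => //; have := eta_r; have := eta_gt0; lra.
Qed.

(** A free point is at least [40 * eta] from [u], hence [20 * eta] in the chart, and [p] loses less
    than [4 * eta]. *)
Let near_tip T u y p : u \in T -> mdist x u <= 3 * r -> free T y ->
  `|Phi u - p| < 4 * eta -> 16 * eta <= `|p - Phi y|.
Proof.
move=> uT xu fy up; have [_ _ /(_ u uT) uy] := fy.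
have : mdist u y <= 2 * `|Phi u - Phi y|.
  by apply: free_norm fy; have := eta_r; have := eta_gt0; lra.
have := ler_distD p (Phi u) (Phi y).
have : 2 * eta <= (1 + L) * eta by rewrite ler_pM2r//; have := L_ge1; lra.
by have := eta_gt0; lra.
Qed.

(** For [y] on the carrot and [z] free, [mdist u z <= mdist u y + mdist y z <= (1 + L) * mdist y z].
    As [z] is far from the tip [u], it is at least [20 * eta] from [y]. *)
Lemma linked_carrot T Q u : Omega u -> u \in T -> mdist x u <= 3 * r ->
  (forall y, mdist u y <= r / 50 -> Q (Phi y)) -> linked T Q (Phi u) (Phi (w u)).
Proof.
move=> Ou uT xu uQ; have [s [ps <- sP]] := carrot Ou.
have {}sP y : y \in u :: s -> [/\ mdist x y <= 4 * r, Q (Phi y) &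
    forall z, free T z -> 10 * eta <= `|Phi y - Phi z|].
  move=> ys; have [uy yL] := sP y ys.
  have xy : mdist x y <= 4 * r.
    by have := metric_triangle x u y; have := eta_r; have := eta_gt0; lra.
  split=> // [|z fz]; first exact: uQ.
  have yz := free_norm xy fz; have [Jz _ /(_ u uT) uz] := fz.
  have := yL z Jz; have := metric_triangle u y z => t1 t2.
  have : (1 + L) * (20 * eta) <= (1 + L) * mdist y z by lra.
  by have := L_ge1 => L1; rewrite ler_pM2l; lra.
clear uQ Ou; have {uT xu} : u \in u :: s by rewrite mem_head.
elim: s u ps sP => [|v s IH] u /=.
  by move=> _ sP /sP[_ Qu _]; exact: Linked0.
move=> /andP[uv ps] sP _; have [xu Qu uf] := sP u (mem_head _ _).
have vs : v \in u :: v :: s by rewrite !inE eqxx orbT.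
have [xv Qv vf] := sP v vs.
apply: (@LinkedS _ _ _ (Phi v)) => // [z fz|].
  have := uf z fz; have := vf z fz; have := Phi_lip u v.
  by have := eta_r; have := eta_gt0; lra.
by apply: IH => //; rewrite ?mem_head// => y ys; apply: sP; rewrite inE ys orbT.
Qed.

(** Down one carrot, across, and up the other. The jump across is at most [delta / 10] long, while
    its ends are [delta] away from [J]. *)
Lemma linked_tips T Q u u' : Omega u -> Omega u' -> u \in T -> u' \in T ->
  mdist x u <= 3 * r -> mdist x u' <= 3 * r -> cell (w u) = cell (w u') ->
  (forall y, mdist u y <= r / 50 -> Q (Phi y)) ->
  (forall y, mdist u' y <= r / 50 -> Q (Phi y)) ->
  linked T Q (Phi u) (Phi u').
Proof.
move=> Ou Ou' uT u'T xu xu' cE uQ u'Q.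
have endP v : Omega v -> mdist x v <= 3 * r ->
    mdist v (w v) <= r / 50 /\ mdist x (w v) <= 4 * r.
  move=> Ov xv; have [s [_ ls sP]] := carrot Ov.
  have [vw _] := sP _ (mem_last _ _); rewrite ls in vw; split => //.
  by have := metric_triangle x v (w v); have := eta_r; have := eta_gt0; lra.
have [uw xw] := endP _ Ou xu; have [uw' xw'] := endP _ Ou' xu'.
apply: linked_trans (linked_carrot Ou uT xu uQ) _.
apply: linked_trans (linkedC (linked_carrot Ou' u'T xu' u'Q)).
apply: linked1; [exact: uQ|exact: u'Q|move=> y fy].
have [Jy _ _] := fy.
have := cellP xw xw' cE; have := Phi_lip (w u) (w u').
have := carrot_end Ou Jy; have := carrot_end Ou' Jy.
have := free_norm xw fy; have := free_norm xw' fy; have := eta_delta.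
by have := eta_r; have := eta_gt0; lra.
Qed.

(** * Following one side of the square *)

Section Side.
Variables (p : nat -> R * R) (N : nat) (Q : set (R * R)).
Hypothesis p_step : forall k, (k < N)%N -> `|p k - p k.+1| <= eta.
Hypothesis p_Q : forall k q, (k <= N)%N -> `|p k - q| <= r / 40 -> Q q.

Definition touches k u : Prop :=
  [/\ Omega u, mdist x u <= 3 * r & `|Phi u - p k| < 4 * eta].

Let pQ k : (k <= N)%N -> Q (p k).
Proof.
by move=> kN; apply: p_Q kN _; rewrite subrr normr0; have := eta_r; have := eta_gt0; lra.
Qed.

(** A free point with image within [4 * eta] of [p k] would have points of [Omega] arbitrarily
    close, and one of them would touch [p k]. *)
Lemma short_untouched k : (k < N)%N -> ~ (exists u, touches k u) ->
  short [::] (p k) (p k.+1).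
Proof.
move=> kN nt y [Jy xy _].
have far : 4 * eta <= `|p k - Phi y|.
  rewrite leNgt; apply/negP => lt.
  have [|u Ou yu] := @Omega_dense y (Num.min r (4 * eta - `|p k - Phi y|)) Jy.
    by rewrite lt_min; have := eta_r; have := eta_gt0; lra.
  move: yu; rewrite lt_min => /andP[yr yu]; apply: nt; exists u; split=> //.
    by have := metric_triangle x y u; have := eta_r; have := eta_gt0; lra.
  have := ler_distD (Phi y) (Phi u) (p k); have := Phi_lip y u.
  by rewrite [ `|Phi u - Phi y|]distrC [ `|Phi y - p k|]distrC; lra.
have := p_step kN; have := ler_distD (p k.+1) (p k) (Phi y).
by have := eta_gt0; lra.
Qed.

(* Each colour, i.e. cell of the end of a carrot, is used once: from the first
   point of that colour one jumps, through the carrots, to the last one. *)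
Lemma linked_side : exists2 T, (size T <= 2 * #|F|)%N & linked T Q (p 0) (p N).
Proof.
(* Induction on the number [m] of remaining steps; [S] contains every colour that can still occur
   from [k] on. Each colour used costs two tips. *)
suff main m : forall n (S : {set F}) k, (k + m)%N = N -> (#|S| <= n)%N ->
    (forall j u, (k <= j <= N)%N -> touches j u -> cell (w u) \in S) ->
    exists2 T, (size T <= 2 * n)%N & linked T Q (p k) (p N).
  by apply: (main N #|F| finset.setT) => [||*]; rewrite ?cardsT ?finset.inE.
elim/ltn_ind: m => m IH n S k kN Sn col.
have [->|kltN] : k = N \/ (k < N)%N by lia.
  by exists [::] => //; exact/Linked0/pQ.
have [[u ku]|nt] := pselect (exists u, touches k u); last first.
  have [||||T sT lT] := IH m.-1 _ n S k.+1; [lia|lia|by []| |].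
    by move=> j u /andP[kj jN]; apply: col; rewrite jN ltnW.
  exists T => //; apply: LinkedS lT; first exact/pQ/ltnW.
  by move=> y /(@free_sub [::] T) fy; apply: short_untouched => //; exact: fy.
have uS : cell (w u) \in S by apply: col ku; rewrite leqnn ltnW.
have n0 : (0 < n)%N by apply: leq_trans Sn; apply/card_gt0P; exists (cell (w u)).
pose same j := (j <= N)%N /\ exists2 v, touches j v & cell (w v) = cell (w u).
have [l [[lN [v lv vE]] kl lmax]] : exists l, [/\ same l, (k <= l)%N &
    forall j, same j -> (j <= l)%N].
  have ex : exists j, `[< same j >].
    by exists k; apply/asboolP; split; [exact: ltnW|exists u].
  have bd j : `[< same j >] -> (j <= N)%N by move=> /asboolP[].
  case: (ex_maxnP ex bd) => l /asboolP sl lmax; exists l; split=> // [|j sj].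
    by apply: lmax; apply/asboolP; split; [exact: ltnW|exists u].
  by apply: lmax; exact/asboolP.
have pnear j z : (j <= N)%N -> touches j z ->
    forall y, mdist z y <= r / 50 -> Q (Phi y).
  move=> jN [_ _ zj] y zy; apply: (p_Q jN).
  have := ler_distD (Phi z) (p j) (Phi y); have := Phi_lip z y.
  by rewrite [ `|p j - Phi z|]distrC; have := eta_r; have := eta_gt0; lra.
have Qtip j z : (j <= N)%N -> touches j z -> Q (Phi z).
  move=> jN jz; apply: (pnear _ _ jN jz); rewrite mdistxx.
  by have := eta_r; have := eta_gt0; lra.
have tip T j z : (j <= N)%N -> touches j z -> z \in T -> linked T Q (p j) (Phi z).
  move=> jN jz zT; apply: linked1; [exact: pQ|exact: Qtip jN jz|move=> y fy].
  have [_ xz zj] := jz; have := near_tip zT xz fy zj.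
  have := ler_distD (Phi z) (p j) (Phi y).
  by rewrite [ `|p j - Phi z|]distrC; have := eta_r; have := eta_gt0; lra.
have jump : linked [:: u; v] Q (p k) (p l).
  have [[Ou xu _] [Ov xv _]] := (ku, lv).
  have uT : u \in [:: u; v] by rewrite inE eqxx.
  have vT : v \in [:: u; v] by rewrite !inE eqxx orbT.
  apply: linked_trans (tip _ _ _ (ltnW kltN) ku uT) _.
  apply: linked_trans (linkedC (tip _ _ _ lN lv vT)).
  by apply: linked_tips => //; [exact: pnear (ltnW kltN) ku|exact: pnear lN lv].
have [lE|lltN] : l = N \/ (l < N)%N by lia.
  by exists [:: u; v]; [rewrite /=; lia|rewrite -lE].
(* By maximality of [l] the colour of [u] does not return, so it is removed from [S]. *)
have [||||T sT lT] := IH (N - l.+1)%N _ n.-1 (S :\ cell (w u))%SET l.+1.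
- lia.
- lia.
- by move: Sn; rewrite (cardsD1 (cell (w u)) S) uS; lia.
- move=> j z /andP[lj jN] jz; rewrite !finset.inE (col j)//; last by rewrite jN; lia.
  rewrite andbT; apply/eqP => zE; have : same j by split => //; exists z.
  by move=> /lmax; lia.
exists [:: u, v & T]; first by rewrite /=; lia.
have sub1 : {subset [:: u; v] <= [:: u, v & T]}.
  by move=> z; rewrite !inE => /orP[] ->; rewrite ?orbT.
have sub2 : {subset T <= [:: u, v & T]}.
  by move=> z; rewrite !inE => ->; rewrite !orbT.
apply: linked_trans (linked_sub sub1 jump) _.
(* The step from [p l] to [p l.+1] is short because the tip [v], close to [p l], keeps free points
   away. *)
apply: LinkedS (linked_sub sub2 lT); first exact: pQ.
move=> y fy; have [_ xv lv'] := lv.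
have vT : v \in [:: u, v & T] by rewrite !inE eqxx orbT.
have := near_tip vT xv fy lv'; have := p_step lltN.
have := ler_distD (p l.+1) (p l) (Phi y).
by have := eta_gt0; lra.
Qed.
End Side.

Lemma linked_segment Q a b :
  (forall (t : R) q, 0 <= t <= 1 -> `|a + t *: (b - a) - q| <= r / 40 -> Q q) ->
  exists2 T, (size T <= 2 * #|F|)%N & linked T Q a b.
Proof.
move=> abQ; have e0 := eta_gt0.
(* The successor makes steps of length at most [eta] and keeps [N] positive when [a = b]. *)
pose N := (Num.truncn (`|b - a| / eta)).+1.
have N0 : 0 < N%:R :> R by rewrite ltr0n.
have NE : `|b - a| <= N%:R * eta.
  have : 0 <= `|b - a| / eta by rewrite divr_ge0// ltW.
  by move=> /truncn_itv/andP[_ /ltW]; rewrite ler_pdivrMr.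
pose p k : R * R := a + (k%:R / N%:R) *: (b - a).
have [||T sT lT] := @linked_side p N Q.
- move=> k kN; rewrite /p opprD addrACA subrr add0r -scalerBl -mulrBl -natr1.
  rewrite opprD addrA subrr add0r normrZ mulN1r normrN gtr0_norm ?invr_gt0//.
  by rewrite mulrC ler_pdivrMr// mulrC.
- move=> k q kN; apply: abQ.
  by rewrite divr_ge0//= ler_pdivrMr// mul1r ler_nat.
exists T => //; move: lT; rewrite /p mul0r scale0r addr0 divff ?gt_eqF//.
by rewrite scale1r addrC subrK.
Qed.

(** * The closed chain and the paths that cross it *)

Hypothesis Phi_x : Phi x = 0.
Hypothesis Phi_far : forall y, mdist x y <= 4 * r -> 2 / 3 * mdist x y <= `|Phi y|.

Lemma linked_loop : exists T q s,
  [/\ (size T <= 8 * #|F|)%N, path (fun a b => `[< short T a b >]) q s, last q s = q,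
    {in q :: s, forall a, `|a| < 6 / 5 * r} &
    forall a, `|a| < r -> winding a q s = 1].
Proof.
(* Chosen so that [r < h - e] and [h + e < 6 / 5 * r]. *)
pose h := 23 / 20 * r; pose e := r / 40.
have r0 : 0 < r by have := eta_r; have := eta_gt0; lra.
have side (a b : R * R) (P : set (R * R)) : `|a| <= h -> `|b| <= h ->
    (forall (t : R) q, `|a + t *: (b - a) - q| <= e -> P q) ->
    exists2 T, (size T <= 2 * #|F|)%N &
      linked T [set q | P q /\ `|q| < 6 / 5 * r] a b.
  move=> ah bh abP; apply: linked_segment => t q /andP[t0 t1] tq.
  split; first exact: abP tq.
  have ct : `|a + t *: (b - a)| <= h.
    rewrite (_ : a + _ = (1 - t) *: a + t *: b); last first.
      by rewrite scalerBr scalerBl scale1r addrA addrAC.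
    apply: le_trans (ler_normD _ _) _; rewrite !normrZ !ger0_norm//; last by lra.
    by have := normr_ge0 a; have := normr_ge0 b; nra.
  have := ler_distD (a + t *: (b - a)) 0 q.
  by rewrite !sub0r !normrN; move: ct tq; rewrite /h /e; lra.
have corner (u v : R) : `|u| = h -> `|v| = h -> `|(u, v)| <= h.
  by move=> uh vh; apply: norm_pair_le; rewrite /= ?uh ?vh.
have hh : `|h| = h by rewrite gtr0_norm// /h; lra.
have hN : `|- h| = h by rewrite normrN.
have norm_fst (u v : R * R) : `|u - v| <= e -> `|v.1 - u.1| <= e.
  by rewrite prod_normE ge_max => /andP[+ _]; rewrite distrC.
have norm_snd (u v : R * R) : `|u - v| <= e -> `|v.2 - u.2| <= e.
  by rewrite prod_normE ge_max => /andP[_]; rewrite distrC.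
have [|||T1 sT1 lT1] := side (h, - h) (h, h) [set q | `|q.1 - h| <= e].
- exact: corner.
- exact: corner.
- by move=> t q /norm_fst; rewrite /= subrr scaler0 addr0.
have [|||T2 sT2 lT2] := side (h, h) (- h, h) [set q | `|q.2 - h| <= e].
- exact: corner.
- exact: corner.
- by move=> t q /norm_snd; rewrite /= subrr scaler0 addr0.
have [|||T3 sT3 lT3] := side (- h, h) (- h, - h) [set q | `|q.1 + h| <= e].
- exact: corner.
- exact: corner.
- by move=> t q /norm_fst; rewrite /= subrr scaler0 addr0 opprK.
have [|||T4 sT4 lT4] := side (- h, - h) (h, - h) [set q | `|q.2 + h| <= e].
- exact: corner.
- exact: corner.
- by move=> t q /norm_snd; rewrite /= subrr scaler0 addr0 opprK.
pose T := T1 ++ T2 ++ T3 ++ T4.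
have [|s1 [p1 l1 q1]] := linked_path (@linked_sub _ T _ _ _ _ lT1).
  by move=> t; rewrite !mem_cat => ->.
have [|s2 [p2 l2 q2]] := linked_path (@linked_sub _ T _ _ _ _ lT2).
  by move=> t; rewrite !mem_cat => ->; rewrite ?orbT.
have [|s3 [p3 l3 q3]] := linked_path (@linked_sub _ T _ _ _ _ lT3).
  by move=> t; rewrite !mem_cat => ->; rewrite ?orbT.
have [|s4 [p4 l4 q4]] := linked_path (@linked_sub _ T _ _ _ _ lT4).
  by move=> t; rewrite !mem_cat => ->; rewrite ?orbT.
exists T, (h, - h), (s1 ++ s2 ++ s3 ++ s4); split.
- by rewrite !size_cat; move: sT1 sT2 sT3 sT4; clear; lia.
- by rewrite !cat_path p1 l1 p2 l2 p3 l3 p4.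
- by rewrite !last_cat l1 l2 l3 l4.
- move=> a; rewrite inE !mem_cat => /or4P[/eqP ->|as1|as2|/orP[as3|as4]].
  + by have [] := q1 _ (mem_head _ _).
  + by have [|] := q1 a; rewrite ?inE ?as1 ?orbT.
  + by have [|] := q2 a; rewrite ?inE ?as2 ?orbT.
  + by have [|] := q3 a; rewrite ?inE ?as3 ?orbT.
  + by have [|] := q4 a; rewrite ?inE ?as4 ?orbT.
- move=> a ar; apply: (@winding_inside _ _ _ _ _ _ _ h e); rewrite ?l1 ?l2 ?l3//.
  + by rewrite /h /e; lra.
  + by move=> c /q1[].
  + by move=> c /q2[].
  + by move=> c /q3[].
  + by move=> c /q4[].
Qed.

Lemma discrete_crossing : exists2 T, (size T <= 8 * #|F|)%N &
  forall y s, {in y :: s, forall z, J z} -> path (fun a b => mdist a b <= eta) y s ->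
    mdist x y < r -> 2 * r < mdist x (last y s) ->
    exists z t, [/\ z \in y :: s, J z, mdist x z <= 19 / 10 * r, t \in T &
      mdist t z < 20 * (1 + L) * eta].
Proof.
have [T [q [c [sT pc lc c_out c_in]]]] := linked_loop.
exists T => // y s sJ ps yr sr; apply: contrapT => no.
have r0 : 0 < r by have := eta_r; have := eta_gt0; lra.
have sfree z : z \in y :: s -> mdist x z <= 19 / 10 * r -> free T z.
  move=> zs xz; split=> //; first exact: sJ.
  move=> t tT; rewrite leNgt; apply/negP => tz; apply: no; exists z, t.
  by split=> //; exact: sJ.
have {}c_in : winding (Phi y) q c = 1.
  apply: c_in; rewrite -[Phi y]subr0 -Phi_x.
  by rewrite (le_lt_trans (Phi_lip _ _))// metric_sym.
have {yr} : mdist x y <= 19 / 10 * r by lra.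
(* The winding number stays 1 along the path. A step needs only its starting point to be free, so it
   remains valid for the first point beyond [19 / 10 * r]. *)
move: c_in {sJ no}; elim: s y ps sr sfree => [|z s IH] y /=.
  by move=> _ yr _ _; lra.
move=> /andP[yz ps] sr sfree wy xy.
have fy : free T y by apply: sfree => //; rewrite mem_head.
have stepyz : `|Phi y - Phi z| <= eta by apply: le_trans yz.
have wz : winding (Phi z) q c = 1.
  rewrite -wy; apply/esym/winding_closed_move => //.
    move: pc; apply: sub_path => a b /asboolP/(_ y fy)[ab _].
    by apply: le_lt_trans ab; rewrite lerD2l.
  case: (c) pc wy => [|b c'] //= /andP[/asboolP/(_ y fy)[qb _] _] _.
  by apply: le_lt_trans stepyz _; apply: le_lt_trans qb; rewrite lerDr.
have [xz|xz] := leP (mdist x z) (19 / 10 * r).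
  apply: IH ps sr _ wz xz => t ts; apply: sfree.
  by rewrite inE ts orbT.
(* Here the image of [z] has norm at least [2 / 3 * (19 / 10 * r)], more than [6 / 5 * r], so the
   winding number would be 0. *)
have xz2 := metric_triangle x y z.
move: wz; rewrite (@winding_outside _ _ _ _ (6 / 5 * r))//.
have := @Phi_far z; have := eta_r.
by move=> e1 e2; have := e2 _; lra.
Qed.

End CrossingChains.

(** * John domains *)

Section JohnCarrots.
Variables (R : realType) (L : R).
Local Notation sphere := (riemann_sphere R).
Implicit Types (Omega : set sphere) (u y z : sphere).

Lemma mdist_le_diam (A : set sphere) y z : A y -> A z ->
  ((mdist y z)%:E <= diam A)%E.
Proof. by move=> Ay Az; apply: ereal_sup_ubound; exists y => //; exists z. Qed.

Lemma John_arc_dist Omega (alpha : set sphere) u z0 : 0 <= L ->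
  John_arc L Omega alpha z0 u ->
  [/\ connected alpha, alpha z0, alpha u &
    forall y z, alpha y -> boundary Omega z -> mdist u y <= L * mdist y z].
Proof.
move=> L0 [a [b [g [[ab gc _ ga gb] -> _ gJ]]]].
have aI : a \in `[a, b] by rewrite in_itv /= lexx.
have bI : b \in `[a, b] by rewrite in_itv /= lexx ab.
split.
- by apply: connected_continuous_connected gc; exact: segment_connected.
- by exists a.
- by exists b.
- move=> _ z [t /= tI <-] Jz; rewrite -lee_fin EFinM.
  have tb : t <= b by move: tI; rewrite in_itv => /andP[].
  rewrite metric_sym.
  apply: le_trans (le_trans (gJ _ tI) _).
    by apply: mdist_le_diam; [exists t|exists b] => //=; rewrite in_itv /= ?lexx ?tb.
  apply: lee_wpmul2l; first by rewrite lee_fin.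
  by apply: ereal_inf_lbound; exists z.
Qed.

(** The John condition at the base-point puts all of [Omega] within [L * mdist z0 z] of [z0], which
    bounds the diameter of the boundary by twice as much. *)
Lemma John_basepoint_far Omega z0 (m : R) z : 0 < L -> Omega z0 ->
  (forall u, Omega u -> exists alpha, John_arc L Omega alpha z0 u) ->
  (m%:E < diam (boundary Omega))%E -> boundary Omega z -> m <= 2 * L * mdist z0 z.
Proof.
move=> L0 Oz0 OJ md Jz; rewrite leNgt; apply/negP => lt.
have bound u : Omega u -> mdist u z0 <= L * mdist z0 z.
  by move=> /OJ[alpha /(John_arc_dist (ltW L0))[_ az0 _ aJ]]; exact: aJ.
move: md; apply/negP; rewrite -leNgt; apply: ge_ereal_sup => _ [y Jy [y' Jy' <-]].
rewrite lee_fin; apply/ler_addgt0Pr => e e0.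
have e2 : 0 < e / 2 by lra.
have [u Ou yu] := closure_mdist Jy.1 e2; have [u' Ou' yu'] := closure_mdist Jy'.1 e2.
have := bound u Ou; have := bound u' Ou'; rewrite [mdist u' z0]metric_sym.
rewrite [mdist y' u']metric_sym in yu'.
have := metric_triangle y u y'; have := metric_triangle u z0 y'.
have := metric_triangle z0 u' y'; lra.
Qed.

Lemma John_carrot Omega (r eta : R) : 1 <= L -> 0 < eta -> 1000 * eta <= r ->
  (r%:E < diam (boundary Omega))%E -> John_domain L Omega ->
  exists w : sphere -> sphere, forall u, Omega u ->
    (exists s, [/\ path (fun y z => mdist y z <= eta) u s, last u s = w u &
      {in u :: s, forall y, mdist u y <= r / 50 /\
        forall z, boundary Omega z -> mdist u y <= L * mdist y z}]) /\
    (forall z, boundary Omega z -> r / (100 * L) <= mdist (w u) z).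
Proof.
move=> L1 eta0 etar rd [_ [z0 Oz0 OJ]].
have L0 : 0 < L by lra.
suff key u : exists w, Omega u ->
    (exists s, [/\ path (fun y z => mdist y z <= eta) u s, last u s = w &
      {in u :: s, forall y, mdist u y <= r / 50 /\
        forall z, boundary Omega z -> mdist u y <= L * mdist y z}]) /\
    (forall z, boundary Omega z -> r / (100 * L) <= mdist w z).
  by have [w wP] := choice key; exists w.
(* Outside [Omega] the value of [w] is arbitrary. *)
have [Ou|nOu] := pselect (Omega u); last by exists u.
have [alpha /(John_arc_dist (ltW L0))[ac az0 au aJ]] := OJ u Ou.
have [s [ps ls sa]] := connected_chain eta0 ac au az0.
(* Either the chain gets [r / 100] away from its tip, and the John condition keeps its end off the
   boundary, or it ends at [z0], which is far by [John_basepoint_far]. *)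
have [|s' [ps' sub bd ends]] := @chain_exit _ _ eta (r / 100) u u s eta0 _ ps.
  by rewrite mdistxx; lra.
have s'J y z : y \in u :: s' -> boundary Omega z -> mdist u y <= L * mdist y z.
  by move=> /sub /sa; exact: aJ.
exists (last u s') => _; split.
  exists s'; split=> // y ys; split; last by move=> z; exact: s'J.
  by have := bd y ys; lra.
move=> z Jz; rewrite ler_pdivrMr; last by lra.
case: ends => [far|->].
  by have := s'J _ _ (mem_last u s') Jz; lra.
rewrite ls; have := John_basepoint_far L0 Oz0 OJ rd Jz.
have : 0 <= L * mdist z0 z by rewrite mulr_ge0 ?mdist_ge0// ltW.
by lra.
Qed.

End JohnCarrots.

(** * Cut sets in the boundary *)

Lemma boundary_cut_set (R : realType) (L : R) : 1 <= L ->
  exists N : nat, forall (Omega : set (riemann_sphere R)) x (r eps : R),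
    John_domain L Omega -> boundary Omega x -> 0 < r -> 40 * r <= 1 ->
    (r%:E < diam (boundary Omega))%E -> 0 < eps -> eps <= (1000 * L)^-1 ->
    exists2 K : seq (riemann_sphere R), (size K <= N)%N &
      {in K, forall k, boundary Omega k /\ mdist x k < 2 * r} /\
      forall y s, {in y :: s, forall z, boundary Omega z} ->
        path (fun a b => mdist a b <= eps * r) y s ->
        mdist x y < r -> 2 * r < mdist x (last y s) ->
        exists2 z, z \in y :: s & exists2 k, k \in K & mdist z k < eps * r.
Proof.
move=> L1; have L0 : 0 < L by lra.
(* At radius [4 * r] this grid has mesh [delta / 10] for [delta = r / (100 * L)]. The net below, at
   radius [20 * (1 + L) * eta], has mesh [eta / 2]. *)
have [|F FP] := @sphere_grid R (4000 * L)^-1; first by rewrite invr_gt0; lra.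
have [|N NP] := @sphere_net R (40 * (1 + L))^-1; first by rewrite invr_gt0; lra.
exists (8 * #|F| * N)%N => Omega x r eps OJ Jx r0 r40 rd eps0 epsL.
pose eta := eps * r; have eta0 : 0 < eta by rewrite mulr_gt0.
have etaL : 1000 * L * eta <= r.
  have epsL1 : eps * (1000 * L) <= 1.
    by move: epsL; rewrite -[(1000 * L)^-1]mul1r ler_pdivlMr; lra.
  have := ler_wpM2r (ltW r0) epsL1; rewrite /eta mul1r; lra.
have eta_r : 1000 * eta <= r.
  by have : eta <= L * eta by [rewrite ler_peMl// ltW]; lra.
have [w wP] := John_carrot L1 eta0 eta_r rd OJ.
have [cell cellP] := FP x (4 * r) ltac:(lra).
have [Phi [Phi_lip Phi_colip Phi_x Phi_far]] := sphere_chart x.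
have eta_delta : 10 * eta <= r / (100 * L).
  by rewrite ler_pdivlMr; move: etaL L0; clear; lra.
have near10 y : mdist x y <= 4 * r -> mdist x y <= 10^-1.
  by move: r40; clear; lra.
have [|||||||T sT TP] := @discrete_crossing R _ Omega (boundary Omega) x L r eta
  (r / (100 * L)) F Phi w cell L1 eta0 eta_r eta_delta Phi_lip.
- by move=> y z /near10 xy /near10; exact: Phi_colip.
- by move=> y e [cy _] e0; exact: closure_mdist.
- by move=> u /wP[].
- by move=> u z /wP[_]; exact.
- move=> y z xy xz /(cellP _ _ xy xz) yz.
  suff -> : r / (100 * L) / 10 = (4000 * L)^-1 * (4 * r) by [].
  by move: L0; clear => L0; field; lra.
- by [].
- by move=> y /near10; exact: Phi_far.
(* The bound [19 / 10 * r] keeps the cut set inside [B(x, 2r)]. *)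
pose X t : set (riemann_sphere R) := [set y | [/\ boundary Omega y,
  mdist x y <= 19 / 10 * r & mdist t y <= 20 * (1 + L) * eta]].
have rho0 : 0 < 20 * (1 + L) * eta by rewrite mulr_gt0//; move: L0; clear; lra.
have /choice[K0 KP] t : exists s : seq (riemann_sphere R),
    [/\ (size s <= N)%N, {in s, forall y, X t y} &
      forall y, X t y -> exists2 k, k \in s & mdist k y <= eta / 2].
  have [|s sP] := NP t (20 * (1 + L) * eta) (X t) rho0; first by move=> y [].
  suff <- : (40 * (1 + L))^-1 * (20 * (1 + L) * eta) = eta / 2 by exists s.
  by move: L0; clear => L0; field; lra.
exists (flatten [seq K0 t | t <- T]).
  apply: (@leq_trans (size T * N)); last by rewrite leq_mul2r sT orbT.
  elim: (T) => [|t T' IH] //=; rewrite size_cat mulSn leq_add//.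
  by have [] := KP t.
split=> [k /flatten_mapP[t _ kt]|y s sJ ps xy xs].
  have [_ /(_ k kt)[Jk xk _] _] := KP t; split=> //.
  by apply: le_lt_trans xk _; move: r0; clear; lra.
have [z [t [zs Jz xz tT tz]]] := TP y s sJ ps xy xs.
have [_ _ /(_ z)[]] := KP t; first by split=> //; exact: ltW.
move=> k kt kz; exists z => //; exists k; first by apply/flatten_mapP; exists t.
rewrite metric_sym; apply: le_lt_trans kz _; rewrite -/eta.
by move: eta0; clear; lra.
Qed.

Theorem theorem1p3 (R : realType) (L : R) (hL : 1 <= L) :
  exists C : R, 1 <= C /\
    forall Omega : set (riemann_sphere R),
      John_domain L Omega -> discrete_UWS C (boundary Omega).
Proof.
have [N1 N1P] := boundary_cut_set hL.
have eps0_gt0 : 0 < (1000 * L)^-1 by rewrite invr_gt0; lra.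
have [|N2 N2P] := @sphere_net R ((1000 * L)^-1 / 2); first by lra.
(* As diameters are at most [pi], the summand 160 forces [40 * r <= 1], so that the chart covers the
   ball of radius [4 * r]. *)
pose C : R := (N1 + N2)%:R + 160.
have C160 : 160 <= C by rewrite /C lerDr.
exists C; split; first by lra.
move=> Omega OJ; split; [lra|exact: sphere_doubling|].
move=> x r Jx r0 rdiam eps /andP[eps0 eps1].
have Cr : C * r < 4.
  have : (r%:E < (C^-1 * pi)%:E)%E.
    apply: lt_le_trans rdiam _; rewrite EFinM; apply: lee_wpmul2l.
      by rewrite lee_fin invr_ge0; lra.
    by apply: ge_ereal_sup => _ [y _ [z _ <-]]; rewrite lee_fin mdist_lepi.
  by rewrite lte_fin mulrC ltr_pdivlMr; have := @pihalf_lt2 R; lra.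
have finish (K : seq (riemann_sphere R)) : (size K <= N1 + N2)%N ->
    {in K, forall k, boundary Omega k /\ mdist x k < 2 * r} ->
    (forall y s, {in y :: s, forall z, boundary Omega z} ->
        path (fun a b => mdist a b <= eps * r) y s ->
        mdist x y < r -> 2 * r < mdist x (last y s) ->
        exists2 z, z \in y :: s & exists2 k, k \in K & mdist z k < eps * r) ->
    exists K : {fset (riemann_sphere R)},
      [/\ [set` K] `<=` boundary Omega `&` ball x (2 * r), #|` K|%:R <= C &
        forall x0 s,
          discrete_path_from_to (boundary Omega) (eps * r)
            (boundary Omega `&` ball x r)
            (boundary Omega `\` [set y | mdist x y <= 2 * r]) x0 s ->
          meets_nbhd (eps * r) [set` K] (x0 :: s)].
  move=> sK KJ Kcut; exists [fset k in K]%fset; split.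
  - by move=> k /=; rewrite inE ballEmdist => /KJ.
  - rewrite (@le_trans _ _ (N1 + N2)%:R)//; last by rewrite /C lerDl.
    by rewrite ler_nat card_fseq (leq_trans (size_undup _)).
  - move=> y s [[sJ ps] [_ yr] [_ /= /negP sr]].
    have [||z zs [k kK zk]] := Kcut y s sJ ps.
    + by move: yr; rewrite ballEmdist.
    + by rewrite ltNge.
    exists z => //; apply: le_lt_trans (_ : ((mdist z k)%:E < _)%E);
      last by rewrite lte_fin.
    by apply: ereal_inf_lbound; exists k => //=; rewrite inE.
have [epsL|epsL] := leP eps (1000 * L)^-1.
  have [||K sK [KJ Kcut]] := N1P Omega x r eps OJ Jx r0 _ _ eps0 epsL.
  - by have : 160 * r <= C * r; [rewrite ler_pM2r|lra].
  - apply: lt_le_trans rdiam _; rewrite -[leRHS]mul1e lee_wpmul2r//.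
      by apply: le_trans (mdist_le_diam Jx Jx); rewrite lee_fin mdist_ge0.
    by rewrite lee_fin invf_le1; lra.
  by apply: (finish K) => //; rewrite (leq_trans sK)// leq_addr.
(* For [eps] bounded below, a net of the whole ball has boundedly many points and already catches
   the first point of the path. *)
have [|K [sK KJ Kcover]] := N2P x r (boundary Omega `&` ball x r) r0.
  by move=> y [_]; rewrite ballEmdist => /ltW.
apply: (finish K); first by rewrite (leq_trans sK)// leq_addl.
  by move=> k /KJ[Jk]; rewrite ballEmdist /= => xk; split=> //; lra.
move=> y s sJ _ xy _; exists y; first exact: mem_head.
have [|k kK ky] := Kcover y.
  by split; [apply: sJ; exact: mem_head|rewrite ballEmdist].
exists k => //; rewrite metric_sym; apply: le_lt_trans ky _.
have := ltr_pM2r r0 (1000 * L)^-1 eps; rewrite epsL => ?.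
have : 0 < (1000 * L)^-1 * r by rewrite mulr_gt0.
by lra.
Qed.
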